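(* Let $A$ be a unital algebraic (not necessarily associative) algebra over a field $F$ of characteristic zero, and fix $\lambda\in F$. (a) For every Rota--Baxter operator $R$ of weight $\lambda$ on $A$ there exist integers $k,l\ge 0$ such that $R^k(R+\lambda\,\mathrm{id})^l=0$. In particular, $\mathrm{Spec}(R)\subset\{0,-\lambda\}$. (b) Suppose that $A$ is algebraic of restricted degree $N$. Then there exists a natural number $n\le N$ such that for every Rota--Baxter operator $R$ of weight $\lambda$ on $A$ one can find $0\le k\le n$ with $R^k(R+\lambda\,\mathrm{id})^{n-k}(1)=0$. Moreover, $\mathrm{rb}_\lambda(A)\le 2n$.
   Context: An algebra over $F$ is an $F$-vector space $A$ with a bilinear product, not assumed associative or commutative; it is unital if it has a two-sided identity element $1$. For $\lambda\in F$, a linear operator $R\colon A\to A$ is a Rota--Baxter operator of weight $\lambda$ if $R(x)R(y)=R(R(x)y+xR(y)+\lambda xy)$ for all $x,y\in A$. $\mathrm{Spec}(R)$ is the spectrum (set of eigenvalues) of $R$. Natural numbers include $0$. An associative algebra is algebraic if each of its elements is a root of a nonzero polynomial over $F$; in the nonassociative case, an algebra is called algebraic if every finite subset of it generates a finite-dimensional subalgebra. An algebraic algebra $A$ is of restricted (bounded) degree $N$ if every element of $A$ is annihilated by a nonzero polynomial over $F$ of degree at most $N$ (powers being $x^0=1$, $x^{i+1}=x^i x$). The Rota--Baxter $\lambda$-index of $A$ is $$\mathrm{rb}_\lambda(A)=\min\{n\in\mathbb N\mid \text{for every Rota--Baxter operator } R \text{ of weight }\lambda\text{ on }A\text{ there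 exists } 0\le k\le n \text{ with } R^k(R+\lambda\,\mathrm{id})^{n-k}=0\},$$ and $\mathrm{rb}_\lambda(A)=\infty$ if no such $n$ exists. *)

(* Defs.v *)
From HB Require Import structures.
From mathcomp Require Import all_boot all_order all_algebra.
From mathcomp Require Import sesquilinear.
From mathcomp Require Import boolp classical_sets.

Set Implicit Arguments.
Unset Strict Implicit.
Unset Printing Implicit Defensive.

Import GRing.Theory.
Local Open Scope ring_scope.
Local Open Scope classical_set_scope.

Section Algebra.
Variables (F : fieldType) (A : lmodType F).
Variables (mul : {bilinear A -> A -> A}) (one : A).

(* Subalgebras are not required to contain the identity; this does not affect
   finite-dimensionality of the generated ones. *)
Definition is_subalgebra (S : set A) : Prop :=
  [/\ S 0,
      forall (a : F) (x y : A), S x -> S y -> S (a *: x + y) &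
      forall x y : A, S x -> S y -> S (mul x y)].

Definition generated_subalgebra (X : set A) : set A :=
  smallest is_subalgebra X.

Definition finite_dimensional (S : set A) : Prop :=
  exists (n : nat) (e : 'I_n -> A),
    S = range (fun c : 'I_n -> F => \sum_(i < n) c i *: e i).

Definition alg_pow (x : A) (i : nat) : A := iter i (fun y => mul y x) one.

Definition alg_eval (p : {poly F}) (x : A) : A :=
  \sum_(i < size p) p`_i *: alg_pow x i.

(* The term has two meanings: elementwise algebraicity when the product is
   associative, finite-dimensionality of all finitely generated subalgebras
   otherwise. The latter is stronger in general, so both cases are kept. *)
Definition algebraic_algebra : Prop :=
  (associative mul ->
     forall x : A, exists2 p : {poly F}, p != 0 & alg_eval p x = 0) /\
  (~ associative mul ->
     forall s : seq A, finite_dimensional (generated_subalgebra [set` s])).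

Definition restricted_degree (N : nat) : Prop :=
  forall x : A, exists p : {poly F},
    [/\ p != 0, ((size p).-1 <= N)%N & alg_eval p x = 0].

Definition RB_operator (lam : F) (R : {linear A -> A}) : Prop :=
  forall x y : A,
    mul (R x) (R y) = R (mul (R x) y + mul x (R y) + lam *: mul x y).

(* R^k (R + lam id)^l *)
Definition RB_word (lam : F) (R : {linear A -> A}) (k l : nat) : A -> A :=
  iter k R \o iter l (fun x => R x + lam *: x).

Definition Spec (R : {linear A -> A}) : set F :=
  [set mu | exists2 v : A, v != 0 & R v = mu *: v].

Definition rb_bound (lam : F) (n : nat) : Prop :=
  forall R : {linear A -> A}, RB_operator lam R ->
    exists2 k : nat, (k <= n)%N & forall x : A, RB_word lam R k (n - k) x = 0.

(* None stands for an infinite index. *)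
Definition rb_index (lam : F) : option nat :=
  match pselect (exists n, `[< rb_bound lam n >]) with
  | left ex_n => Some (ex_minn ex_n)
  | right _ => None
  end.

End Algebra.

Definition index_le (r : option nat) (m : nat) : Prop :=
  if r is Some n then (n <= m)%N else False.

(* Main.v *)
(** Put [b_n = R^n(1)]. The Rota-Baxter identity gives
    [b_n b_1 = (n+1) b_(n+1) + n lam b_n], so right multiplication by [R(1)]
    acts on the vectors [f(R)(1)] through the differential operator
    [f |-> X f + X (X + lam) f']. As [R(1)] is algebraic and the characteristic
    is zero, [1] has a minimal annihilator [g] in [F[X]], of degree at most
    that of an annihilator of [R(1)]; the annihilators form an ideal stable
    under the operator, so [g] divides [X (X + lam) g'] and hence
    [g = X^k (X + lam)^l]. Finally [R^k (R + lam)^l (1) = 0] forces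
    [R^(k+l) (R + lam)^(k+l) = 0] on the whole algebra, by eliminating [t]
    from the two-variable form [t s = r (t + s + lam)] of the identity. *)

Require Import Defs.
From HB Require Import structures.
From mathcomp Require Import all_boot all_order all_algebra.
From mathcomp Require Import sesquilinear.
From mathcomp Require Import ring zify.
From mathcomp Require Import boolp classical_sets.

Set Implicit Arguments.
Unset Strict Implicit.
Unset Printing Implicit Defensive.

Import GRing.Theory.
Local Open Scope ring_scope.
Local Open Scope classical_set_scope.

(** * Polynomials in a linear operator and annihilators of a vector *)

Section PolynomialsInOperator.
Variables (F : fieldType) (A : lmodType F) (R : {linear A -> A}).

Definition op_eval (f : {poly F}) (v : A) : A :=
  \sum_(i < size f) f`_i *: iter i R v.

Lemma op_eval_wide n (f : {poly F}) v :
  (size f <= n)%N -> op_eval f v = \sum_(i < n) f`_i *: iter i R v.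
Proof.
move=> le_fn; rewrite /op_eval (big_ord_widen n (fun i => f`_i *: iter i R v)) //.
rewrite [RHS](bigID (fun i : 'I_n => (i < size f)%N)) /=.
rewrite [X in _ = _ + X]big1 ?addr0 // => i.
by rewrite -leqNgt => /(nth_default 0) ->; rewrite scale0r.
Qed.

Lemma op_eval_linear v : linear (op_eval ^~ v).
Proof.
move=> c f g; set n := maxn (size f) (size g).
have [lf lg] : (size f <= n)%N /\ (size g <= n)%N.
  by rewrite leq_maxl leq_maxr.
rewrite !(@op_eval_wide n) //; last first.
  rewrite (leq_trans (size_polyD _ _)) // geq_max lg andbT.
  by rewrite (leq_trans (size_scale_leq _ _)).
rewrite scaler_sumr -big_split /=; apply: eq_bigr => i _.
by rewrite coefD coefZ scalerDl scalerA.
Qed.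

Lemma op_evalD f g v : op_eval (f + g) v = op_eval f v + op_eval g v.
Proof. by rewrite -[f in LHS]scale1r op_eval_linear scale1r. Qed.

Lemma op_evalC c v : op_eval c%:P v = c *: v.
Proof.
rewrite (@op_eval_wide 1) ?size_polyC ?leq_b1 //.
by rewrite big_ord1 coefC.
Qed.

Lemma op_eval0 v : op_eval 0 v = 0.
Proof. by rewrite op_evalC scale0r. Qed.

Lemma op_eval1 v : op_eval 1 v = v.
Proof. by rewrite op_evalC scale1r. Qed.

Lemma op_evalZ c f v : op_eval (c *: f) v = c *: op_eval f v.
Proof. by rewrite -[c *: f]addr0 op_eval_linear op_eval0 addr0. Qed.

Lemma op_evalB f g v : op_eval (f - g) v = op_eval f v - op_eval g v.
Proof. by rewrite op_evalD -[- g in LHS]scaleN1r op_evalZ scaleN1r. Qed.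

Lemma op_evalMX f v : op_eval (f * 'X) v = R (op_eval f v).
Proof.
rewrite (@op_eval_wide (size f).+1); last first.
  by rewrite (leq_trans (size_polyMleq _ _)) // size_polyX addn2.
rewrite big_ord_recl coefMX /= scale0r add0r linear_sum.
by apply: eq_bigr => i _; rewrite coefMX /= linearZ_LR.
Qed.

Lemma op_evalM f g v : op_eval (f * g) v = op_eval f (op_eval g v).
Proof.
elim/poly_ind: f => [|f c IHf]; first by rewrite mul0r !op_eval0.
rewrite mulrDl !op_evalD mulrAC !op_evalMX IHf.
by rewrite mul_polyC op_evalZ op_evalC.
Qed.

Lemma op_evalX v : op_eval 'X v = R v.
Proof. by rewrite -['X]mul1r op_evalMX op_eval1. Qed.

Lemma op_eval_id0 f : op_eval f 0 = 0.
Proof.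
rewrite /op_eval big1 // => i _; suff -> : iter i R 0 = 0 by rewrite scaler0.
by elim: (i : nat) => //= n ->; rewrite linear0.
Qed.

(** As polynomials in [R] the factors of a word commute and can be regrouped. *)
Lemma RB_wordE lam k l v :
  RB_word lam R k l v = op_eval ('X ^+ k * ('X + lam%:P) ^+ l) v.
Proof.
have iterE (T : A -> A) p n w : (forall x, T x = op_eval p x) ->
    iter n T w = op_eval (p ^+ n) w.
  move=> TE; elim: n => [|n IHn]; first by rewrite op_eval1.
  by rewrite exprS op_evalM -IHn /= TE.
rewrite op_evalM /RB_word /= (iterE _ 'X) => [|x]; last by rewrite op_evalX.
by rewrite (iterE _ ('X + lam%:P)) // => x; rewrite op_evalD op_evalX op_evalC.
Qed.

(** A nonzero annihilator of least size divides all others, since the remainder of a division by it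
    again kills [v]. *)
Lemma minimal_annihilator v f : f != 0 -> op_eval f v = 0 ->
  exists2 g, g != 0 /\ op_eval g v = 0 &
    forall h, op_eval h v = 0 -> g %| h.
Proof.
move=> f_neq0 fv0.
pose P n := `[< exists g, [/\ g != 0, op_eval g v = 0 & size g = n] >].
have exP : exists n, P n by exists (size f); apply/asboolP; exists f.
case: (ex_minnP exP) => n /asboolP[g [g_neq0 gv0 <-]] min_g.
exists g => // h hv0; apply: contraT; rewrite /dvdp -size_poly_eq0 => h_ndvd.
have r_neq0 : h %% g != 0 by rewrite -size_poly_eq0.
have /min_g : P (size (h %% g)).
  apply/asboolP; exists (h %% g); split=> //.
  have -> : h %% g = h - (h %/ g) * g by rewrite {2}(divp_eq h g) addrAC subrr add0r.
  by rewrite op_evalB op_evalM gv0 hv0 op_eval_id0 subrr.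
by rewrite leqNgt ltn_modp g_neq0.
Qed.

End PolynomialsInOperator.

(** * Polynomials dividing X (X + lam) times their derivative, in characteristic zero *)

Section CharZeroPolynomials.
Variables (F : fieldType) (charF0 : [pchar F] =i pred0).

Lemma natr_neq0 n : (n.+1)%:R != 0 :> F.
Proof. by rewrite ((pcharf0P F).1 charF0). Qed.

(** Differentiation lowers the degree, so h' must vanish; in characteristic zero this leaves only
    constants. *)
Lemma size_of_dvdp_deriv (h : {poly F}) : h != 0 -> h %| h^`() -> size h = 1%N.
Proof.
move=> h_neq0 h_dvd; have h'0 : h^`() = 0.
  apply: contraTeq h_dvd => h'_neq0.
  by rewrite gtNdvdp // lt_size_deriv.
have : (size h > 0)%N by rewrite lt0n size_poly_eq0.
case szh: (size h) => [|[|n]] // _.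
have /eqP : h^`()`_n = 0 by rewrite h'0 coef0.
rewrite coef_deriv -mulr_natr mulf_eq0 (negPf (natr_neq0 n)) orbF.
have -> : h`_n.+1 = lead_coef h by rewrite lead_coefE szh.
by rewrite lead_coef_eq0 (negPf h_neq0).
Qed.

Variable lam : F.

Lemma deriv_XkXl k l (h : {poly F}) :
  'X * ('X + lam%:P) * ('X ^+ k * ('X + lam%:P) ^+ l * h)^`() =
  'X ^+ k * ('X + lam%:P) ^+ l * 
   (h * ('X + lam%:P) *+ k + h * 'X *+ l + 'X * ('X + lam%:P) * h^`()).
Proof.
(* At n = 0 the truncated exponent [n.-1] is harmless: the factor n kills the term. *)
have XM (p : {poly F}) n : p * (p ^+ n.-1 *+ n) = p ^+ n * n%:R.
  by case: n => [|n]; rewrite mulrnAr mulr_natr ?mulr0n // exprS.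
have key (x p a b xk pl h' : {poly F}) :
    x * a = xk * k%:R -> p * b = pl * l%:R ->
  x * p * ((a * pl + xk * b) * h + xk * pl * h') =
  xk * pl * (h * p *+ k + h * x *+ l + x * p * h').
  move=> xa pb.
  transitivity (x * a * p * pl * h + p * b * x * xk * h + x * p * xk * pl * h').
    by ring.
  by rewrite xa pb -(mulr_natr _ k) -(mulr_natr _ l); ring.
rewrite !derivM !deriv_exp !derivD derivC derivX addr0 !mul1r.
exact: key.
Qed.

(** Strip all factors X and X + lam from [g]: the cofactor h is coprime to both and, after
    cancellation, divides X (X + lam) h', hence h', so it is constant. *)
Lemma factor_of_dvdp_deriv (g : {poly F}) : g != 0 ->
  g %| 'X * ('X + lam%:P) * g^`() ->
  exists k l c, [/\ c != 0, (k + l)%N = (size g).-1 &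
    g = c *: ('X ^+ k * ('X + lam%:P) ^+ l)].
Proof.
move=> g_neq0 g_dvd.
have [k [q]] := multiplicity_XsubC g 0; rewrite g_neq0 /= subr0 => q0 gE.
have q_neq0 : q != 0 by apply: contraNneq g_neq0 => q0'; rewrite gE q0' mul0r.
have [l [h]] := multiplicity_XsubC q (- lam).
rewrite q_neq0 /= polyCN opprK => hlam qE.
have h_neq0 : h != 0 by apply: contraNneq q_neq0 => h0'; rewrite qE h0' mul0r.
have h0 : ~~ root h 0 by apply: contra q0; rewrite qE rootM => ->.
have {}gE : g = 'X ^+ k * ('X + lam%:P) ^+ l * h by rewrite gE qE mulrC [h * _]mulrC mulrA.
have w_monic : 'X ^+ k * ('X + lam%:P) ^+ l \is monic.
  by rewrite monicMl ?monic_exp ?monicX // monicXaddC.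
have h1 : size h = 1%N.
  apply: size_of_dvdp_deriv => //; move: g_dvd.
  rewrite gE deriv_XkXl dvdp_mul2l ?monic_neq0 // dvdp_addr; last first.
    by rewrite -!mulrnAr; apply: dvdp_add; apply: dvdp_mulr.
  rewrite Gauss_dvdpr // coprimepMr coprimepX h0.
  by rewrite -[lam]opprK polyCN coprimep_XsubC.
have /size_poly1P[c c_neq0 hE] : size h == 1%N by rewrite h1.
exists k, l, c; split=> //; last by rewrite gE hE mulrC mul_polyC.
rewrite gE size_monicM // h1 addn1 /= size_monicM ?monic_exp ?monicX //; last first.
  by rewrite monic_neq0 // monic_exp // monicXaddC.
by rewrite size_polyXn -[lam]opprK polyCN size_exp_XsubC addSn addnS.
Qed.

(* With [f] standing for [f(R) 1], this is right multiplication by [R 1]. *)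
Definition mul_R1 (f : {poly F}) : {poly F} :=
  'X * f + 'X * ('X + lam%:P) * f^`().

(** The coefficient of X^(m+1) in [mul_R1 f] is (m+1) (f_m + lam f_(m+1)): the degree rises by one
    and the leading coefficient is multiplied by a positive integer, nonzero in F. *)
Lemma size_iter_mul_R1 n : size (iter n mul_R1 1) = n.+1.
Proof.
elim: n => [|n IHn]; first by rewrite size_poly1.
rewrite iterS; move: (iter n _ _) IHn => f szf.
have coef_f m : (n < m)%N -> f`_m = 0 by move=> ?; rewrite nth_default ?szf.
have coefM m : (mul_R1 f)`_m.+1 = f`_m *+ m.+1 + lam * f`_m.+1 *+ m.+1.
  rewrite /mul_R1 coefD coefXM -mulrA coefXM /= mulrDl coefD coefXM mul_polyC coefZ.
  rewrite !coef_deriv; case: m => [|m] /=; first by rewrite add0r mulr1n.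
  by rewrite addrA -mulrS mulrnAr.
apply/eqP; rewrite eqn_leq; apply/andP; split.
  apply/leq_sizeP => -[|m] // lt_nm; rewrite coefM !coef_f ?mul0rn ?mulr0 ?mul0rn ?addr0 //.
  exact: ltnW.
apply: contraTltn (natr_neq0 n) => lt_sz.
have /eqP := nth_default 0 lt_sz; rewrite coefM (coef_f n.+1) // mulr0 mul0rn addr0.
rewrite negbK -(mulr_natr f`_n) mulf_eq0 => /orP[|->] //.
have -> : f`_n = lead_coef f by rewrite lead_coefE szf.
by rewrite lead_coef_eq0 -size_poly_eq0 szf.
Qed.

(** The i-th iterate has degree exactly i, so the top term cannot cancel. *)
Lemma size_sum_iter_mul_R1 (p : {poly F}) :
  size (\sum_(i < size p) p`_i *: iter i mul_R1 1) = size p.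
Proof.
case szp: (size p) => [|n]; first by rewrite big_ord0 size_poly0.
have pn : p`_n != 0.
  have -> : p`_n = lead_coef p by rewrite lead_coefE szp.
  by rewrite lead_coef_eq0 -size_poly_eq0 szp.
rewrite big_ord_recr /= addrC size_polyDl size_scale ?size_iter_mul_R1 // ltnS.
rewrite (leq_trans (size_sum _ _ _)) //; apply/bigmax_leqP => i _.
by rewrite (leq_trans (size_scale_leq _ _)) // size_iter_mul_R1.
Qed.

End CharZeroPolynomials.

(** * Right multiplication by R(1), and the passage from 1 to the whole algebra *)

Section RotaBaxter.
Variables (F : fieldType) (A : lmodType F).
Variables (mul : {bilinear A -> A -> A}) (one : A) (lam : F).
Variables (R : {linear A -> A}) (RB : RB_operator mul lam R).
Hypotheses (mul1x : left_id one mul) (mulx1 : right_id one mul).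

Local Notation w k l := ('X ^+ k * ('X + lam%:P) ^+ l).

(** Induction along Horner's scheme: for u = f(R)(1) the identity gives R(u) R(1) = R(R(u) + u R(1)
    + lam u), which matches the recursion of [mul_R1] under f |-> f X + c. *)
Lemma op_eval_mul_R1 f :
  op_eval R (mul_R1 lam f) one = mul (op_eval R f one) (R one).
Proof.
elim/poly_ind: f => [|f c IHf].
  by rewrite /mul_R1 deriv0 !mulr0 addr0 op_eval0 linear0l.
have -> : mul_R1 lam (f * 'X + c%:P) =
    (mul_R1 lam f + ('X + lam%:P) * f) * 'X + c *: 'X.
  by rewrite /mul_R1 derivMXaddC -mul_polyC; ring.
rewrite !op_evalD !op_evalMX op_evalC op_evalZ op_evalX op_evalD IHf.
rewrite linearDl linearZl_LR mul1x; congr (_ + _).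
rewrite RB mulx1 mulx1 mulrDl op_evalD mul_polyC op_evalZ mulrC op_evalMX.
by rewrite addrCA addrA.
Qed.

Lemma op_eval_iter_mul_R1 i :
  op_eval R (iter i (mul_R1 lam) 1) one = alg_pow mul one (R one) i.
Proof.
elim: i => [|i IHi]; first by rewrite op_eval1.
by rewrite iterS op_eval_mul_R1 IHi.
Qed.

Lemma op_eval_alg_eval (p : {poly F}) :
  op_eval R (\sum_(i < size p) p`_i *: iter i (mul_R1 lam) 1) one =
  alg_eval mul one p (R one).
Proof.
rewrite (big_morph (op_eval R ^~ one) (fun f g => op_evalD R f g one)
  (op_eval0 R one)); apply: eq_bigr => i _.
by rewrite /= op_evalZ op_eval_iter_mul_R1.
Qed.

Lemma RB_word_one (p : {poly F}) : [pchar F] =i pred0 ->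
    p != 0 -> alg_eval mul one p (R one) = 0 ->
  exists k l, (k + l <= (size p).-1)%N /\ op_eval R (w k l) one = 0.
Proof.
move=> charF0 p_neq0; rewrite -op_eval_alg_eval.
set f := \sum_(_ < _) _ => f0.
have szf : size f = size p by exact: size_sum_iter_mul_R1.
have f_neq0 : f != 0 by rewrite -size_poly_eq0 szf size_poly_eq0.
have [g [g_neq0 g0] min_g] := minimal_annihilator f_neq0 f0.
(* The image X g + X (X + lam) g' also kills 1, so g divides it; dropping X g leaves g dividing X (X
   + lam) g'. *)
have /min_g : op_eval R (mul_R1 lam g) one = 0.
  by rewrite op_eval_mul_R1 g0 linear0l.
rewrite /mul_R1 (dvdp_addr _ (dvdp_mull _ (dvdpp g))) => /(factor_of_dvdp_deriv charF0 g_neq0).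
move=> [k [l [c [c_neq0 szg gE]]]]; exists k, l; split.
  by rewrite szg -szf -!subn1 leq_sub2r // dvdp_leq // min_g.
move/eqP: g0; rewrite gE op_evalZ scaler_eq0 (negPf c_neq0) => /eqP //.
Qed.

(* Let [t], [s], [r] denote [R] applied to [v], to [y] and to [mul v y]. The
   Rota-Baxter identity reads [t s = r (t + s + lam)]; [RB_shift n] is the
   action of [(s - r)^n], for which [(s - r) t = r (s + lam)] and
   [(s - r) (t + lam) = (r + lam) s]. *)
Fixpoint RB_shift n (v y : A) : A :=
  if n is n'.+1 then RB_shift n' v (R y) - R (RB_shift n' v y) else mul v y.

Lemma RB_shift0 n y : RB_shift n 0 y = 0.
Proof.
by elim: n y => [|n IHn] y /=; rewrite ?linear0l // !IHn linear0 subrr.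
Qed.

Lemma RB_shiftX n v y :
  op_eval R 'X (RB_shift n v (op_eval R ('X + lam%:P) y)) =
  RB_shift n.+1 (op_eval R 'X v) y.
Proof.
rewrite op_evalD op_evalC !op_evalX.
(* For n = 0 this is the Rota-Baxter identity; further factors s - r commute with r and s. *)
elim: n y => [|n IHn] y.
  rewrite /= RB -linearB; congr (R _).
  by rewrite linearDr linearZr_LR [RHS]addrC -addrA addKr.
rewrite [LHS]/= linearB [R (R y + _)]linearD linearZ_LR !IHn.
by [].
Qed.

Lemma RB_shiftXaddC n v y :
  op_eval R ('X + lam%:P) (RB_shift n v (op_eval R 'X y)) =
  RB_shift n.+1 (op_eval R ('X + lam%:P) v) y.
Proof.
rewrite !op_evalD !op_evalC !op_evalX.
elim: n y => [|n IHn] y.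
  rewrite /= [mul _ (R y) in RHS]linearDl linearZl_LR RB addrAC -linearB; congr (R _ + _).
  rewrite linearDl linearZl_LR [X in X + _ - _]addrC -(addrA (mul v _)).
  by rewrite addrK.
rewrite [LHS]/= linearB scalerBr addrACA -opprD -linearZ_LR -linearD !IHn.
by [].
Qed.

(** Each factor [p] outside the product, paired with a factor [q] on [y], moves onto [v] at the cost
    of one more s - r. *)
Lemma RB_shift_exp (p q : {poly F}) k n v y :
    (forall m u z, op_eval R p (RB_shift m u (op_eval R q z)) =
                   RB_shift m.+1 (op_eval R p u) z) ->
  op_eval R (p ^+ k) (RB_shift n v (op_eval R (q ^+ k) y)) =
  RB_shift (k + n) (op_eval R (p ^+ k) v) y.
Proof.
move=> pq; elim: k n v y => [|k IHk] n v y; first by rewrite !op_eval1.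
by rewrite exprSr exprS !op_evalM pq IHk addSnnS.
Qed.

Lemma RB_word_square k l y : op_eval R (w k l) one = 0 ->
  op_eval R (w (k + l) (k + l)) y = 0.
Proof.
(* The pairing is crossed: each outer X + lam consumes an inner X and each outer X an inner X + lam,
   so that all of [w k l] lands on 1 and kills it. *)
have -> : w (k + l) (k + l) = w k l * ('X^l * ('X + lam%:P) ^+ k).
  by rewrite !exprD; ring.
rewrite !op_evalM => w0; rewrite -[op_eval R 'X^l _]mul1x.
rewrite -[mul one _]/(RB_shift 0 one _).
rewrite (RB_shift_exp _ _ _ _ RB_shiftXaddC) (RB_shift_exp _ _ _ _ RB_shiftX).
by rewrite w0 RB_shift0.
Qed.

End RotaBaxter.

(** * Algebraicity, eigenvalues and the index *)

Lemma alg_eval_annihilator (F : fieldType) (A : lmodType F)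
    (mul : {bilinear A -> A -> A}) (one : A) :
    algebraic_algebra mul one ->
  forall x, exists2 p : {poly F}, p != 0 & alg_eval mul one p x = 0.
Proof.
move=> [assocA nassocA] x.
(* Including 1 among the generators puts x^0 in the subalgebra too. *)
have [/assocA//|/nassocA/(_ [:: one; x])] := pselect (associative mul).
move=> [n [e genE]].
have gen i : exists c : 'I_n -> F, alg_pow mul one x i = \sum_(j < n) c j *: e j.
  suff : generated_subalgebra mul [set` [:: one; x]] (alg_pow mul one x i).
    by rewrite genE => -[c _ <-]; exists c.
  move=> S [[_ _ SM] XS]; elim: i => [|i IHi] /=.
    by apply: XS; rewrite /= inE eqxx.
  by apply: SM => //; apply: XS; rewrite /= !inE eqxx orbT.
have [c cE] := choice gen.
(* Row i holds coordinates of x^i; with n + 1 rows and n columns there is a nonzero left kernel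
   vector, whose entries are the coefficients sought. *)
pose M := \matrix_(i < n.+1, j < n) c i j.
have /rowV0Pn[u /sub_kermxP uM u_neq0] : kermx M != 0.
  by rewrite kermx_eq0 /row_free neq_ltn ltnS rank_leq_col.
have pE (i : 'I_n.+1) : (rVpoly u)`_i = u 0 i by rewrite coef_rVpoly_ord.
exists (rVpoly u).
  by apply: contraNneq u_neq0 => u0; rewrite -[u]rVpolyK u0 linear0.
have le_sz : (size (rVpoly u) <= n.+1)%N by exact: size_poly.
rewrite /alg_eval (big_ord_widen n.+1 (fun i => (rVpoly u)`_i *: alg_pow mul one x i)) //.
rewrite big_mkcond /=.
transitivity (\sum_(i < n.+1) \sum_(j < n) (u 0 i * M i j) *: e j).
  apply: eq_bigr => i _; case: ltnP => [_|/(nth_default 0)].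
    rewrite pE cE scaler_sumr; apply: eq_bigr => j _.
    by rewrite mxE scalerA.
  by rewrite pE => ->; rewrite big1 // => j _; rewrite mul0r scale0r.
rewrite exchange_big big1 //= => j _; rewrite -scaler_suml.
by move/matrixP/(_ 0 j): uM; rewrite !mxE => ->; rewrite scale0r.
Qed.

Theorem theorem1 (F : fieldType) (charF0 : [pchar F] =i pred0)
  (A : lmodType F) (mul : {bilinear A -> A -> A}) (one : A)
  (mul1x : left_id one mul) (mulx1 : right_id one mul)
  (algA : algebraic_algebra mul one) (lam : F) :
  (forall R : {linear A -> A}, RB_operator mul lam R ->
     (exists k l : nat, forall x : A, RB_word lam R k l x = 0) /\
     Spec R `<=` [set 0; - lam]) /\
  (forall N : nat, restricted_degree mul one N ->
     exists n : nat,
       [/\ (n <= N)%N,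
           forall R : {linear A -> A}, RB_operator mul lam R ->
             exists2 k : nat, (k <= n)%N & RB_word lam R k (n - k) one = 0 &
           index_le (rb_index mul lam) (2 * n)]).
Proof.
have wordK (R : {linear A -> A}) (p : {poly F}) : RB_operator mul lam R ->
    p != 0 -> alg_eval mul one p (R one) = 0 ->
    exists2 kl : nat * nat, (kl.1 + kl.2 <= (size p).-1)%N &
    op_eval R ('X ^+ kl.1 * ('X + lam%:P) ^+ kl.2) one = 0.
  move=> RB p0 pR; have [k [l [? ?]]] := RB_word_one RB mul1x mulx1 charF0 p0 pR.
  by exists (k, l).
split=> [R RB|N degN].
  have [p p0 pR] := alg_eval_annihilator algA (R one).
  have [[k l] _ /= w0] := wordK R p RB p0 pR.
  have sq y : RB_word lam R (k + l) (k + l) y = 0.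
    by rewrite RB_wordE; apply: RB_word_square.
  split; first by exists (k + l)%N, (k + l)%N.
  move=> mu [v v0 Rv]; have := sq v; rewrite RB_wordE.
  (* On an eigenvector f(R) is the scalar f(mu), so [mu] is a root of the vanishing word. *)
  have evalv f : op_eval R f v = f.[mu] *: v.
    elim/poly_ind: f => [|f c IHf]; first by rewrite op_eval0 horner0 scale0r.
    rewrite op_evalD op_evalMX op_evalC IHf linearZ_LR Rv scalerA -scalerDl.
    by rewrite hornerMXaddC.
  move/eqP; rewrite evalv scaler_eq0 (negPf v0) orbF !hornerE mulf_eq0.
  rewrite !expf_eq0.
  case/orP=> /andP[_ /eqP mu0]; [left|right] => //=.
  by apply/eqP; rewrite -addr_eq0 mu0.
have wordN (R : {linear A -> A}) : RB_operator mul lam R ->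
    exists2 k : nat, (k <= N)%N & RB_word lam R k (N - k) one = 0.
  move=> RB; have [p [p0 szp pR]] := degN (R one).
  have [[k l] /= le_kl w0] := wordK R p RB p0 pR.
  have le_klN := leq_trans le_kl szp.
  exists k; first exact: leq_trans (leq_addr _ _) le_klN.
  (* Surplus factors X + lam bring the total exponent up to N. *)
  have -> : (N - k)%N = (N - (k + l) + l)%N by lia.
  rewrite RB_wordE exprD mulrCA op_evalM w0; exact: op_eval_id0.
(* Both exponents on the whole algebra become k + (N - k) = N, whatever k is for the given R. *)
have rb2N : rb_bound mul lam (2 * N).
  move=> R RB; have [k le_kN w0] := wordN R RB; exists N; first by lia.
  move=> x; have -> : (2 * N - N)%N = N by lia.
  have NE : (k + (N - k))%N = N by rewrite subnKC.
  move: w0; rewrite !RB_wordE => /(RB_word_square RB mul1x x).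
  by rewrite NE.
(* N itself serves as n; the index, being the least bound, is at most 2N. *)
exists N; split=> //; rewrite /rb_index; case: pselect => [ex_n|[]] /=.
  by case: ex_minnP => m _; apply; apply/asboolP.
by exists (2 * N)%N; apply/asboolP.
Qed.
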